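(* Let $\mathbf{L}=\langle L,\wedge,\vee,\otimes,\rightarrow,0,1\rangle$ be a complete residuated lattice. Let $\mathcal{D}$ and $\mathcal{D}'$ be ranked data tables on a relation scheme $T$ and let $y\in T$, $d\in D_y$, and $R\subseteq T$. Then \begin{align*} S(\mathcal{D},\mathcal{D}')&\leq S(\pi_R(\mathcal{D}),\pi_R(\mathcal{D}')),\\ S(\mathcal{D},\mathcal{D}')&\leq S(\sigma_{y\approx d}(\mathcal{D}),\sigma_{y\approx d}(\mathcal{D}')). \end{align*}
   Context: A complete residuated lattice $\mathbf{L}=\langle L,\wedge,\vee,\otimes,\rightarrow,0,1\rangle$ is a complete lattice with least element $0$ and greatest element $1$ such that $\langle L,\otimes,1\rangle$ is a commutative monoid and, for all $a,b,c\in L$, $a\otimes b\leq c$ if and only if $a\leq b\rightarrow c$. $Y$ is a set of attributes; a relation scheme is any subset $T\subseteq Y$. Each $y\in Y$ has a domain $D_y$ (a set) equipped with a similarity $\approx_y\colon D_y\times D_y\to L$, i.e., $u\approx_y u=1$ and $u\approx_y v=v\approx_y u$ for all $u,v\in D_y$. Put $\mathrm{Tupl}(T)=\prod_{y\in T}D_y$; its elements $t$ (maps with $t(y)\in D_y$ for $y\in T$) are tuples over $T$. A ranked data table (RDT) on $T$ is a (finite) $\mathbf{L}$-set in $\mathrm{Tupl}(T)$, i.e., a map $\mathcal{D}\colon\mathrm{Tupl}(T)\to L$ (finite meaning that only finitely many tuples have nonzero value). For $R\subseteq T$, $r\in\mathrm{Tupl}(R)$, $s\in\mathrm{Tupl}(T\setminus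 R)$, the concatenation $rs\in\mathrm{Tupl}(T)$ is given by $(rs)(y)=r(y)$ for $y\in R$ and $(rs)(y)=s(y)$ for $y\in T\setminus R$. The projection of $\mathcal{D}$ onto $R$ is the RDT on $R$ given by $(\pi_R(\mathcal{D}))(r)=\bigvee_{s\in\mathrm{Tupl}(T\setminus R)}\mathcal{D}(rs)$. The similarity-based selection is the RDT on $T$ given by $(\sigma_{y\approx d}(\mathcal{D}))(t)=\mathcal{D}(t)\otimes(t(y)\approx_y d)$. For RDTs $\mathcal{D},\mathcal{D}'$ on the same scheme $T$, the subsethood degree is $S(\mathcal{D},\mathcal{D}')=\bigwedge_{t\in\mathrm{Tupl}(T)}\bigl(\mathcal{D}(t)\rightarrow\mathcal{D}'(t)\bigr)\in L$. *)

(* Defs.v *)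
From HB Require Import structures.
From mathcomp Require Import all_boot all_order.
From mathcomp Require Import boolp classical_sets functions cardinality.

Set Implicit Arguments.
Unset Strict Implicit.
Unset Printing Implicit Defensive.

Import Order.TTheory.
Local Open Scope classical_set_scope.
Local Open Scope order_scope.

(* The constants 0 and 1 are \bot and \top; no 0 != 1 requirement. *)
HB.mixin Record isCompleteResiduated d (L : Type)
    of Order.TBLattice d L := {
  has_supremums : forall A : set L, supremums A !=set0 ;
  has_infimums : forall A : set L, infimums A !=set0 ;
  otimes : L -> L -> L ;
  residuum : L -> L -> L ;
  otimesA : associative otimes ;
  otimesC : commutative otimes ;
  otimes1x : left_id (\top : L) otimes ;
  adjointness : forall a b c : L, (otimes a b <= c) <-> (a <= residuum b c)
}.

#[short(type="completeResiduatedLatticeType")]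
HB.structure Definition CompleteResiduatedLattice d :=
  { L of Order.TBLattice d L & isCompleteResiduated d L }.

(* The library's supremum and infimum return their first argument on the
   empty set, so \bot and \top are the right defaults. *)
Definition bigvee d (L : completeResiduatedLatticeType d) (I : Type)
  (f : I -> L) : L := supremum \bot (range f).

Definition bigwedge d (L : completeResiduatedLatticeType d) (I : Type)
  (f : I -> L) : L := infimum \top (range f).

Lemma bigvee_isLub d (L : completeResiduatedLatticeType d) (I : Type)
  (f : I -> L) : isLub (range f) (bigvee f).
Proof.
rewrite /bigvee /supremum; case: ifPn => [/eqP ->|_].
  by split=> // b _; exact: le0x.
have [x xs] := has_supremums (range f).
by case: (xgetI \bot xs) => ub lub; split.
Qed.

Lemma bigwedge_isGlb d (L : completeResiduatedLatticeType d) (I : Type)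
  (f : I -> L) :
  (forall i, bigwedge f <= f i) /\
  (forall b, (forall i, b <= f i) -> b <= bigwedge f).
Proof.
rewrite /bigwedge /infimum; case: ifPn => [/eqP r0|_].
  split=> [i|b _]; last exact: lex1.
  by have : range f (f i) by []; rewrite r0.
have [x xs] := has_infimums (range f).
case: (xgetI \top xs) => lb glb; split=> [i|b bf]; first exact: lb.
by apply: glb => _ [i _ <-].
Qed.

Definition is_similarity d (L : completeResiduatedLatticeType d) (X : Type)
  (e : X -> X -> L) : Prop :=
  (forall u, e u u = \top) /\ (forall u v, e u v = e v u).

Section RankedDataTables.
Context d (L : completeResiduatedLatticeType d).
Context (Y : Type) (Dom : Y -> Type).

Definition Tupl (T : set Y) : Type := forall y : T, Dom (val y).

(* L-sets without a finite-support restriction; finite tables are those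
   satisfying [finite_rdt], which projection and selection preserve
   ([finite_rdt_proj], [finite_rdt_sel]). *)
Definition rdt (T : set Y) : Type := Tupl T -> L.

Definition finite_rdt (T : set Y) (D : rdt T) : Prop :=
  finite_set [set t | D t <> \bot].

(* Meant for R `<=` T; then R and T `\` R partition T. *)
Definition concat (T R : set Y) (r : Tupl R) (s : Tupl (T `\` R)) : Tupl T :=
  fun y => match pselect (R (val y)) with
  | left Ry => r (SigSub (mem_set Ry))
  | right nRy => s (SigSub (mem_set (conj (set_valP y) nRy)))
  end.

Definition proj (T R : set Y) (D : rdt T) : rdt R :=
  fun r => bigvee (fun s : Tupl (T `\` R) => D (concat r s)).

Definition sel (sim : forall y, Dom y -> Dom y -> L) (T : set Y)
  (y : T) (a : Dom (val y)) (D : rdt T) : rdt T :=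
  fun t => otimes (D t) (sim (val y) (t y) a).

Definition subsethood (T : set Y) (D D' : rdt T) : L :=
  bigwedge (fun t : Tupl T => residuum (D t) (D' t)).

Lemma otimes0x (a : L) : otimes \bot a = \bot.
Proof. by apply/le_anti; rewrite le0x andbT; apply/adjointness; exact: le0x. Qed.

Lemma finite_rdt_sel (sim : forall y, Dom y -> Dom y -> L) (T : set Y)
  (y : T) (a : Dom (val y)) (D : rdt T) :
  finite_rdt D -> finite_rdt (sel sim a D).
Proof.
by apply: sub_finite_set => t /= st D0; apply: st; rewrite /sel D0 otimes0x.
Qed.

Definition restr (T R : set Y) (RT : R `<=` T) (t : Tupl T) : Tupl R :=
  fun y => t (SigSub (mem_set (RT _ (set_valP y)))).

Lemma restr_concat (T R : set Y) (RT : R `<=` T) (r : Tupl R)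
  (s : Tupl (T `\` R)) : restr RT (concat r s) = r.
Proof.
apply: functional_extensionality_dep => -[y yR]; rewrite /restr /concat /=.
case: pselect => [Ry|/=]; last by move=> h; case: h; exact: set_mem.
by rewrite (bool_irrelevance (mem_set Ry) yR).
Qed.

Lemma finite_rdt_proj (T R : set Y) (D : rdt T) :
  R `<=` T -> finite_rdt D -> finite_rdt (proj (R := R) D).
Proof.
move=> RT Dfin; apply: (sub_finite_set _ (finite_image (restr RT) Dfin)).
move=> r /= pr; apply: contrapT => nr; apply: pr.
apply/le_anti; rewrite le0x andbT.
apply: (bigvee_isLub _).2 => _ [s _ <-].
suff -> : D (concat r s) = \bot by [].
apply: contrapT => D0; apply: nr; exists (concat r s) => //.
exact: restr_concat.
Qed.

End RankedDataTables.

Arguments proj {d L Y Dom T} R D.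

(* Main.v *)
(** By adjointness, [S(D, D')] is the greatest [c] with [c * D t <= D' t] for
    all [t].  This property passes to selections since [*] is associative and
    monotone, and to projections since [c * x <= b] iff [x <= c -> b], so that
    it is enough to bound each member of the supremum. *)

Require Import Defs.
From HB Require Import structures.
From mathcomp Require Import all_boot all_order.
From mathcomp Require Import boolp classical_sets functions cardinality.

Import Order.TTheory.

Local Open Scope classical_set_scope.
Local Open Scope order_scope.

(** Adjointness gives [b <= residuum c (otimes b c)]; prefix [a <= b] and transpose back. *)
Lemma le_otimesl (disp : Order.disp_t)
  (L : completeResiduatedLatticeType disp) (a b c : L) :
  a <= b -> otimes a c <= otimes b c.
Proof.
by move=> ab; apply/adjointness; apply: (le_trans ab); apply/adjointness.
Qed.

Lemma le_subsethoodP (disp : Order.disp_t)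
  (L : completeResiduatedLatticeType disp) (Y : Type) (Dom : Y -> Type)
  (T : set Y) (D D' : rdt L Dom T) (c : L) :
  c <= subsethood D D' <-> forall t, otimes c (D t) <= D' t.
Proof.
have [lb glb] := bigwedge_isGlb (fun t => residuum (D t) (D' t)).
split=> [cS t|cD]; first by apply/adjointness; exact: le_trans (lb t).
by apply: glb => t; apply/adjointness.
Qed.

Theorem theorem3 (disp : Order.disp_t) (L : completeResiduatedLatticeType disp)
  (Y : Type) (Dom : Y -> Type) (sim : forall y : Y, Dom y -> Dom y -> L)
  (sim_similarity : forall y : Y, is_similarity (sim y))
  (T : set Y) (D D' : rdt L Dom T)
  (y : T) (a : Dom (val y)) (R : set Y) (RT : R `<=` T) :
  subsethood D D' <= subsethood (proj R D) (proj R D') /\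
  subsethood D D' <= subsethood (sel sim a D) (sel sim a D').
Proof.
(* The instance [c := subsethood D D'], used pointwise in both halves. *)
have SD := (le_subsethoodP _ _ _ _ _ D D' _).1 (lexx _).
split; apply/le_subsethoodP => t; last by rewrite /sel otimesA; exact: le_otimesl.
(* Transposing the degree leaves the supremum [proj R D t] alone on the left, to be bounded one [s]
   at a time. *)
rewrite otimesC; apply/adjointness; apply: (bigvee_isLub _).2 => _ [s _ <-].
apply/adjointness; rewrite otimesC; apply: (le_trans (SD _)).
(* The same extension [s] of [t] serves for [D']. *)
by apply: (bigvee_isLub _).1; exists s.
Qed.
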